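(* Let $0<\beta\le 1/3$ and let $K_\beta$ be the Cantor set associated with the sequence $\ell_s=\beta^s$, $s\ge 0$. For $s\ge 1$ let $Y_{s-1}$ be the set of the $2^{s}$ endpoints of the basic intervals of level $s-1$. Then $\Lambda_{2^s}(Y_{s-1},K_\beta)\to\infty$ as $s\to\infty$.
   Context: Geometrically symmetric Cantor sets: let $(\ell_s)_{s\ge 0}$ be a sequence of positive numbers with $\ell_0=1$ and $3\ell_{s+1}\le \ell_s$ for all $s\ge 0$. Put $E_0=I_{1,0}=[0,1]$; given $E_s=\bigcup_{j=1}^{2^s} I_{j,s}$, a disjoint union of closed intervals (''basic intervals of level $s$'') of length $\ell_s$ (numbered from left to right), $E_{s+1}$ is obtained by replacing each $I_{j,s}$ by two closed subintervals $I_{2j-1,s+1}$ and $I_{2j,s+1}$ of length $\ell_{s+1}$, the first sharing the left endpoint and the second the right endpoint of $I_{j,s}$. The associated Cantor set is $K=\bigcap_{s\ge0}E_s$. $Y_k$ denotes the set of endpoints of the basic intervals of level $k$, so $Y_0=\{0,1\}$ and $\#(Y_k)=2^{k+1}$. Lebesgue constant: for a set $Z=\{x_1,\dots,x_N\}$ of $N$ distinct points of a compact set $K\subset\mathbb R$, let $l_k(x)=\prod_{i\ne k}\frac{x-x_i}{x_k-x_i}$ ($1\le k\le N$) and $\Lambda_N(Z,K)=\sup_{x\in K}\sum_{k=1}^N|l_k(x)|$. *)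

(* Defs.v *)
From HB Require Import structures.
From mathcomp Require Import all_boot all_order all_algebra.
From mathcomp Require Import finmap.
From mathcomp Require Import all_classical all_reals all_analysis.
From mathcomp Require Import lra.

Set Implicit Arguments.
Unset Strict Implicit.
Unset Printing Implicit Defensive.

Import Order.TTheory GRing.Theory Num.Theory.
Import numFieldNormedType.Exports.

Local Open Scope classical_set_scope.
Local Open Scope ring_scope.

Section CantorSets.
Variable R : realType.
Implicit Types (l : nat -> R) (I : R * R).

Definition cantor_scale l : Prop :=
  [/\ forall s, 0 < l s, l 0%N = 1 & forall s, 3 * l s.+1 <= l s].

(* An interval [a, b] is encoded by the pair (a, b). *)
Definition split_interval (r : R) I : seq (R * R) :=
  [:: (I.1, I.1 + r); (I.2 - r, I.2)].

(* The intervals I_{1,s}, ..., I_{2^s,s}, from left to right. *)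
Fixpoint basic_intervals l (s : nat) : seq (R * R) :=
  if s is t.+1 then flatten (map (split_interval (l t.+1)) (basic_intervals l t))
  else [:: (0, 1)].

Definition cantor_level l (s : nat) : set R :=
  \bigcup_(I in [set` basic_intervals l s]) `[I.1, I.2]%classic.

Definition cantor_set l : set R := \bigcap_s cantor_level l s.

Definition endpoint_seq (s : seq (R * R)) : seq R :=
  flatten [seq [:: p.1; p.2] | p <- s].

Definition endpoints l (k : nat) : {fset R} :=
  [fset x in endpoint_seq (basic_intervals l k)]%fset.

End CantorSets.

Section Lebesgue.
Variable R : realType.

Definition lagrange_basis (Z : {fset R}) (z x : R) : R :=
  \prod_(y <- Z | y != z) ((x - y) / (z - y)).

Definition lebesgue_function (Z : {fset R}) (x : R) : R :=
  \sum_(z <- Z) `|lagrange_basis Z z x|.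

(* The supremum is taken in the extended reals, so that no boundedness
   side condition is needed; the subscript N is the cardinal of Z. *)
Definition lebesgue_constant (Z : {fset R}) (K : set R) : \bar R :=
  ereal_sup [set (lebesgue_function Z x)%:E | x in K].

End Lebesgue.

Section Facts.
Variable R : realType.
Implicit Types (l : nat -> R) (I : R * R).

Lemma cantor_scale_geometric (beta : R) :
  0 < beta -> beta <= 1 / 3 -> cantor_scale (fun s => beta ^+ s).
Proof.
move=> b0 b1; split=> [s||s]; rewrite ?expr0 ?exprn_gt0//.
rewrite exprS mulrA; apply: ler_piMl; first by rewrite exprn_ge0// ltW.
lra.
Qed.

Lemma size_basic_intervals l s : size (basic_intervals l s) = (2 ^ s)%N.
Proof.
elim: s => //= s IH; rewrite expnS -IH.
by elim: (basic_intervals l s) => //= I t ->; rewrite mulnS.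
Qed.

Lemma basic_intervals_length l s : cantor_scale l ->
  forall I, I \in basic_intervals l s -> I.2 - I.1 = l s.
Proof.
move=> [_ l0 _]; case: s => [|s] I /=.
  by rewrite inE => /eqP -> /=; rewrite l0 subr0.
move=> /flatten_mapP[J _]; rewrite !inE => /orP[] /eqP -> /=; lra.
Qed.

Lemma sorted_endpoint_seq l s : cantor_scale l ->
  sorted <%R (endpoint_seq (basic_intervals l s)).
Proof.
move=> hl; have [lp l0 l3] := hl; elim: s => [|s]; first by rewrite /= ltr01.
have := basic_intervals_length (s := s) hl; rewrite /=.
set t := basic_intervals l s => ht.
suff H u x : {subset u <= t} -> path <%R x (endpoint_seq u) ->
    path <%R x (endpoint_seq (flatten (map (split_interval (l s.+1)) u))).
  case: t ht H => [//|I t] ht H.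
  have /(_ (I.1 - 1)) := H (I :: t) _ (fun=> id).
  rewrite /= => /[swap] /= /andP[h1 h2]; rewrite h1 h2 ltrBlDr ltrDl ltr01 /=.
  by move=> /(_ isT).
elim: u x => //= I u IH x /= sub /and3P[h1 h2 h3].
rewrite IH ?h1 ?andbT//=; last by move=> J Ju; apply: sub; rewrite inE Ju orbT.
have := ht I (sub _ (mem_head _ _)).
have := lp s.+1; have := l3 s => ? ? ?.
by apply/and3P; split; lra.
Qed.

Lemma card_endpoints l k : cantor_scale l ->
  #|` endpoints l k|%fset = (2 ^ k.+1)%N.
Proof.
move=> hl; rewrite /endpoints card_fseq undup_id; last first.
  by apply: (sorted_uniq lt_trans ltxx); exact: sorted_endpoint_seq.
rewrite expnS -(size_basic_intervals l k) /endpoint_seq.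
by elim: (basic_intervals l k) => //= I t ->; rewrite mulnS.
Qed.

End Facts.

(* Main.v *)
(** A single fundamental polynomial is already unbounded: the one attached to
    the node [z = l 1], the right end of the left half of the Cantor set,
    evaluated at a point [x > 0] of the Cantor set very close to the node [0].
    Up to a factor [x / (2 z)], its value there is
    [prod_(y != 0) y / prod_(y != z) |z - y|], the product over all nodes [y].
    The reflection [y |-> z - y] of the left half exchanges [0] and [z], so the
    nodes of the left half cancel, while each of the [2 ^ k] nodes of the right
    half contributes [y / (y - z) >= 1 / (1 - z)].  The resulting factor
    [(1 - z) ^- (2 ^ k)] is doubly exponential in the level [k], whereas [x]
    need only be exponentially small. *)

Require Import Defs.
From HB Require Import structures.
From mathcomp Require Import all_boot all_order all_algebra.
From mathcomp Require Import finmap.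
From mathcomp Require Import all_classical all_reals all_analysis.
From mathcomp Require Import ring lra zify.
Import Order.TTheory GRing.Theory Num.Theory.
Import numFieldNormedType.Exports.
Local Open Scope classical_set_scope.
Local Open Scope ring_scope.

(** * Location and reflection symmetries of the nodes *)

Section Endpoints.
Set Implicit Arguments.
Unset Strict Implicit.
Context {R : realType}.
Implicit Types (l : nat -> R) (u : seq (R * R)) (I : R * R) (y : R).

Lemma endpoint_seqP u y :
  reflect (exists2 I, I \in u & y = I.1 \/ y = I.2) (y \in endpoint_seq u).
Proof.
apply: (iffP flatten_mapP) => -[I Iu yI]; exists I => //.
  by move: yI; rewrite !inE => /orP[/eqP->|/eqP->]; [left|right].
by rewrite !inE; case: yI => ->; rewrite eqxx ?orbT.
Qed.

Lemma basic_intervalsSP l s I :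
  reflect (exists2 J, J \in basic_intervals l s &
             I = (J.1, J.1 + l s.+1) \/ I = (J.2 - l s.+1, J.2))
          (I \in basic_intervals l s.+1).
Proof.
apply: (iffP flatten_mapP) => -[J Ju IJ]; exists J => //.
  by move: IJ; rewrite !inE => /orP[/eqP->|/eqP->]; [left|right].
by rewrite !inE; case: IJ => ->; rewrite eqxx ?orbT.
Qed.

Lemma basic_intervals_left l s : cantor_scale l -> (0, l s) \in basic_intervals l s.
Proof.
move=> [_ l0 _]; elim: s => [|s IH]; first by rewrite /= l0 inE.
by apply/basic_intervalsSP; exists (0, l s) => //; left; rewrite /= add0r.
Qed.

(** A left child keeps its parent's left end, and a right child starts at least [2 * l s.+1]
    further, since [3 * l s.+1 <= l s]. This isolates the node [0]: all other nodes of level [s] are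
    at distance at least [l s] from it. *)
Lemma basic_intervals_ge l s I : cantor_scale l -> I \in basic_intervals l s ->
  I.1 = 0 \/ l s <= I.1.
Proof.
move=> hl; have [lp l0 l3] := hl.
elim: s I => [|s IH] I; first by rewrite inE => /eqP ->; left.
have := lp s.+1; have := l3 s => l3s lps.
move=> /basic_intervalsSP[J Js]; have lJ := basic_intervals_length hl Js.
have := IH _ Js => -[J0|lJ1] [->|->] /=; [left|right|right|right]; lra.
Qed.

Lemma basic_intervals_refl1 l s I : cantor_scale l -> I \in basic_intervals l s ->
  (1 - I.2, 1 - I.1) \in basic_intervals l s.
Proof.
move=> hl; elim: s I => [|s IH] I.
  by rewrite !inE => /eqP -> /=; rewrite subrr subr0.
move=> /basic_intervalsSP[J /IH Js IJ]; apply/basic_intervalsSP.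
exists (1 - J.2, 1 - J.1) => //; case: IJ => -> /=; [right|left];
  by congr pair; lra.
Qed.

(** Splitting commutes with the reflection [y |-> l 1 - y], which merely swaps the two children, so
    the symmetry of the left half passes from level to level. The induction starts at level 1, the
    first one with two halves. *)
Lemma basic_intervals_halves l s I : cantor_scale l ->
  I \in basic_intervals l s.+1 ->
  I.2 <= l 1%N /\ (l 1%N - I.2, l 1%N - I.1) \in basic_intervals l s.+1
  \/ 1 - l 1%N <= I.1.
Proof.
move=> hl; have [lp l0 l3] := hl.
elim: s I => [|s IH] I.
  rewrite !inE /= => /orP[] /eqP -> /=; [left|right]; last by [].
  by rewrite !add0r subrr subr0 lexx eqxx.
move=> /basic_intervalsSP[J Js IJ]; have lJ := basic_intervals_length hl Js.
have := lp s.+2; have := l3 s.+1 => l3s lps.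
have [[J2 Jr]|J1] := IH _ Js; last first.
  by right; case: IJ => -> /=; lra.
left; split; first by case: IJ => -> /=; lra.
apply/basic_intervalsSP; exists (l 1%N - J.2, l 1%N - J.1) => //.
by case: IJ => -> /=; [right|left]; congr pair; lra.
Qed.

Lemma endpoint_left l s : cantor_scale l -> 0 \in endpoint_seq (basic_intervals l s).
Proof.
move=> hl; apply/endpoint_seqP; exists (0, l s); last by left.
exact: basic_intervals_left.
Qed.

Lemma endpoint_leftr l s : cantor_scale l -> l s \in endpoint_seq (basic_intervals l s).
Proof.
move=> hl; apply/endpoint_seqP; exists (0, l s); last by right.
exact: basic_intervals_left.
Qed.

Lemma endpoint_seqS l s y : y \in endpoint_seq (basic_intervals l s) ->
  y \in endpoint_seq (basic_intervals l s.+1).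
Proof.
move=> /endpoint_seqP[I Is [->|->]]; apply/endpoint_seqP.
- exists (I.1, I.1 + l s.+1); last by left.
  by apply/basic_intervalsSP; exists I => //; left.
- exists (I.2 - l s.+1, I.2); last by right.
  by apply/basic_intervalsSP; exists I => //; right.
Qed.

Lemma endpoint_seq_le l s t y : (s <= t)%N ->
  y \in endpoint_seq (basic_intervals l s) ->
  y \in endpoint_seq (basic_intervals l t).
Proof.
move=> /subnK <-; elim: (t - s)%N => // n IH /IH; exact: endpoint_seqS.
Qed.

Lemma endpoint_ge l s y : cantor_scale l ->
  y \in endpoint_seq (basic_intervals l s) -> y = 0 \/ l s <= y.
Proof.
move=> hl /endpoint_seqP[I Is]; have lI := basic_intervals_length hl Is.
have [lp _ _] := hl; have := lp s => lps.
have := basic_intervals_ge hl Is => -[I0|I1] [->|->]; [left|right|right|right]; lra.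
Qed.

Lemma endpoint_refl1 l s y : cantor_scale l ->
  y \in endpoint_seq (basic_intervals l s) ->
  1 - y \in endpoint_seq (basic_intervals l s).
Proof.
move=> hl /endpoint_seqP[I Is yI]; apply/endpoint_seqP.
exists (1 - I.2, 1 - I.1); first exact: basic_intervals_refl1.
by case: yI => ->; [right|left].
Qed.

Lemma endpoint_ge0 l s y : cantor_scale l ->
  y \in endpoint_seq (basic_intervals l s) -> 0 <= y.
Proof.
move=> hl /(endpoint_ge hl)[->//|]; apply: le_trans.
by have [lp _ _] := hl; exact: ltW.
Qed.

Lemma endpoint_le1 l s y : cantor_scale l ->
  y \in endpoint_seq (basic_intervals l s) -> y <= 1.
Proof. by move=> hl /(endpoint_refl1 hl)/(endpoint_ge0 hl); rewrite subr_ge0. Qed.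

Lemma endpoint_halves l s y : cantor_scale l ->
  y \in endpoint_seq (basic_intervals l s.+1) ->
  y <= l 1%N /\ l 1%N - y \in endpoint_seq (basic_intervals l s.+1)
  \/ 1 - l 1%N <= y.
Proof.
move=> hl /endpoint_seqP[I Is yI]; have lI := basic_intervals_length hl Is.
have [lp _ _] := hl; have := lp s.+1 => lps.
have [[I2 Ir]|I1] := basic_intervals_halves hl Is; last first.
  by right; case: yI => ->; lra.
left; split; first by case: yI => ->; lra.
apply/endpoint_seqP; exists (l 1%N - I.2, l 1%N - I.1) => //.
by case: yI => ->; [right|left].
Qed.

Lemma endpoint_cantor_level l s y : cantor_scale l ->
  y \in endpoint_seq (basic_intervals l s) -> cantor_level l s y.
Proof.
move=> hl /endpoint_seqP[I Is yI]; exists I => //=.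
have lI := basic_intervals_length hl Is; have [lp _ _] := hl; have := lp s => lps.
by rewrite in_itv/=; case: yI => ->; apply/andP; split; lra.
Qed.

Lemma cantor_scale_le l s t : cantor_scale l -> (s <= t)%N -> l t <= l s.
Proof.
move=> [lp _ l3] /subnK <-; elim: (t - s)%N => // n; apply: le_trans.
by rewrite addSn; have := l3 (n + s)%N; have := lp (n + s).+1; lra.
Qed.

(** The point [l m] is a node of level [m], hence of all later levels, and it lies in the leftmost
    interval [[0, l s]] of every earlier level. Such points serve as evaluation points near [0]. *)
Lemma cantor_set_scale l m : cantor_scale l -> cantor_set l (l m).
Proof.
move=> hl s _; have [lp _ _] := hl; have [ms|sm] := leqP m s.
  apply: endpoint_cantor_level => //; apply: endpoint_seq_le ms _.
  exact: endpoint_leftr.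
exists (0, l s); first exact: basic_intervals_left.
by rewrite /= in_itv/= (ltW (lp _)) cantor_scale_le// ltnW.
Qed.

Lemma mem_endpoints l s y :
  (y \in enum_fset (endpoints l s)) = (y \in endpoint_seq (basic_intervals l s)).
Proof. by rewrite -[LHS]/(y \in endpoints l s) /endpoints !inE. Qed.

End Endpoints.

(** * Lower bound for the fundamental polynomial at the node [l 1] *)

Lemma Bernoulli_le (R : realDomainType) (t : R) (n : nat) :
  0 <= t -> t <= 1 -> 1 - n%:R * t <= (1 - t) ^+ n.
Proof.
move=> t0 t1; elim: n => [|n IH]; first by rewrite mul0r subr0 expr0.
rewrite exprS; apply: le_trans (ler_wpM2l _ IH); last by rewrite subr_ge0.
have : 0 <= n%:R * t * t by rewrite !mulr_ge0.
by rewrite -natr1; lra.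
Qed.

Section LowerBound.
Set Implicit Arguments.
Unset Strict Implicit.
Context {R : realType}.
Variables (l : nat -> R) (k : nat).
Hypothesis hl : cantor_scale l.
Let Y := enum_fset (endpoints l k.+1).
Let b := l 1%N.

Let b_gt0 : 0 < b. Proof. by have [+ _ _] := hl; apply. Qed.
Let b_le3 : 3 * b <= 1. Proof. by have [_ l0 /(_ 0%N)] := hl; rewrite l0. Qed.

(** The reflection [y |-> 1 - y] permutes the nodes and sends the left half into the right half, so
    at least half of the [2 ^ k.+2] nodes lie on the right. *)
Lemma count_endpoints_right :
  (2 ^ k.+1 <= count (fun y => (1 - b <= y)%R) Y)%N.
Proof.
have sY : size Y = (2 ^ k.+2)%N := card_endpoints k.+1 hl.
have pY : perm_eq Y [seq 1 - y | y <- Y].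
  apply: uniq_perm; first exact: fset_uniq.
    by rewrite map_inj_uniq ?fset_uniq// => y z; lra.
  move=> y; apply/idP/mapP => [yY|[z zY ->]]; last first.
    by move: zY; rewrite !mem_endpoints; exact: endpoint_refl1.
  exists (1 - y); last lra.
  by move: yY; rewrite !mem_endpoints; exact: endpoint_refl1.
(* Of two copies of the count, one is transported by the reflection. The conditions [1 - b <= y] and
   [1 - b <= 1 - y] then cover all nodes, and the count of their overlap is discarded. *)
rewrite -(@leq_pmul2l 2)// -expnS -sY mul2n -addnn.
rewrite {2}(permP pY) count_map -count_predUI -(count_predT Y).
apply: leq_trans (leq_addr _ _).
rewrite [leqRHS](@eq_in_count _ _ predT)// => y.
rewrite mem_endpoints => /(endpoint_halves hl)[[yb _]|y1] /=; apply/orP.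
  by right; rewrite -/b in yb; lra.
by left.
Qed.

(** Reindexing by [y |-> b - y], which permutes the left nodes and exchanges [0] and [b]. *)
Lemma prod_endpoints_left :
  \prod_(y <- Y | (y != b) && (y <= b)) (b - y) =
  \prod_(y <- Y | (y != 0) && (y <= b)) y.
Proof.
have pY : perm_eq [seq y <- Y | y <= b] [seq b - y | y <- Y & y <= b].
  apply: uniq_perm; first by rewrite filter_uniq ?fset_uniq.
    by rewrite map_inj_uniq ?filter_uniq ?fset_uniq// => y z; lra.
  have H y : y \in [seq y <- Y | y <= b] -> b - y \in [seq y <- Y | y <= b].
    rewrite !mem_filter !mem_endpoints => /andP[yb yY].
    rewrite lerBlDr lerDl (endpoint_ge0 hl yY)/=.
    have [[]//|by1] := endpoint_halves hl yY.
    by exfalso; rewrite -/b in by1; have := b_gt0; have := b_le3; lra.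
  move=> y; apply/idP/mapP => [/H yY|[z /H zY ->//]].
  by exists (b - y) => //; lra.
have E (P : pred R) (F : R -> R) : \prod_(y <- Y | P y && (y <= b)) F y =
    \prod_(y <- [seq y <- Y | y <= b] | P y) F y.
  by rewrite big_filter_cond; apply: eq_bigl => y; rewrite andbC.
rewrite !E [RHS](perm_big _ pY) big_map; apply: eq_bigl => y.
by rewrite subr_eq0 eq_sym.
Qed.

(** The factor [2 ^+ k.+3] is twice the number of nodes: with [x] this small, replacing [|x - y|] by
    [y] at all nonzero nodes costs at most a factor 2, which is the 2 in [2 * b]. *)
Lemma lagrange_basis_ge (x : R) : 0 < x -> x * 2 ^+ k.+3 <= l k.+1 ->
  x / (2 * b) * (1 - b) ^- (2 ^ k.+1) <=
  `|lagrange_basis (endpoints l k.+1) b x|.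
Proof.
move=> x0 xl; have [lp _ _] := hl; have := b_le3; have := b_gt0 => b0 b3.
have l1b : l k.+1 <= b by exact: cantor_scale_le.
have uY : uniq Y := fset_uniq _.
have bY : b \in Y.
  by rewrite mem_endpoints; apply: endpoint_seq_le (endpoint_leftr 1 hl).
have zY : 0 \in Y by rewrite mem_endpoints endpoint_left.
have geY y : y \in Y -> y != 0 -> l k.+1 <= y.
  by rewrite mem_endpoints => /(endpoint_ge hl)[->|//]; rewrite eqxx.
have rY y : y \in Y -> ~~ (y <= b) -> 1 - b <= y.
  by rewrite mem_endpoints => /(endpoint_halves hl)[[-> //]|].
have leY y : y \in Y -> y <= 1 by rewrite mem_endpoints; exact: endpoint_le1.
have xb : x < b.
  apply: lt_le_trans l1b; apply: lt_le_trans xl.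
  by rewrite ltr_pMr// exprn_egt1// ltr1n.
set P := \prod_(y <- Y | y != 0) y.
set M := \prod_(y <- Y | y != 0) `|x - y|.
set N := \prod_(y <- Y | y != b) `|x - y|.
set D := \prod_(y <- Y | y != b) `|b - y|.
have P0 : 0 <= P.
  rewrite /P big_seq_cond prodr_ge0// => y /andP[yY y0].
  exact: le_trans (ltW (lp _)) (geY _ yY y0).
have D0 : 0 < D.
  by rewrite /D prodr_gt0// => y yb; rewrite normr_gt0 subr_eq0 eq_sym.
(* Both sides are the product of [|x - y|] over all nodes, with the factor of [0], respectively of
   [b], pulled out. *)
have xMN : x * M = (b - x) * N.
  have : \prod_(y <- Y) `|x - y| = \prod_(y <- Y) `|x - y| by [].
  rewrite {1}(bigD1_seq 0)// (bigD1_seq b)//= subr0 gtr0_norm//.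
  by rewrite ltr0_norm ?subr_lt0// opprB.
have PM : P / 2 <= M.
  (* Nonzero nodes are at least [l k.+1], so [t] bounds every ratio [x / y] and
     [|x - y| >= (1 - t) * y]. There are at most [2 ^ k.+2] such factors and [t <= 2 ^- k.+3], so
     Bernoulli's inequality keeps the product of the [1 - t] above 1/2. *)
  pose t := x / l k.+1.
  have t0 : 0 < t by rewrite divr_gt0.
  have t1 : t * 2 ^+ k.+3 <= 1 by rewrite /t mulrAC ler_pdivrMr// mul1r.
  have t1' : t <= 1 by apply: le_trans t1; rewrite ler_peMr ?(ltW t0)// exprn_ege1// ler1n.
  apply: (@le_trans _ _ (\prod_(y <- Y | y != 0) ((1 - t) * y))); last first.
    rewrite /M big_seq_cond [leRHS]big_seq_cond.
    apply: ler_prod => y /andP[yY y0].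
    have ly := geY _ yY y0; rewrite mulr_ge0 ?subr_ge0//=; last first.
      exact: le_trans (ltW (lp _)) ly.
    rewrite distrC; apply: le_trans (ler_norm _).
    rewrite mulrBl mul1r lerD2l lerN2 /t mulrAC ler_pdivlMr//.
    by rewrite ler_pM2l.
  rewrite big_split /= mulrC ler_wpM2r//.
  rewrite big_const_seq iter_mulr_1.
  apply: le_trans (Bernoulli_le _ (ltW t0) t1').
  have : (count (fun y => y != 0) Y)%:R * t <= 2 ^+ k.+2 * t.
    rewrite ler_pM2r// -natrX ler_nat -(card_endpoints k.+1 hl).
    exact: count_size.
  by move: t1; rewrite exprS; lra.
have DP : (1 - b) ^- (2 ^ k.+1) * D <= P.
  have b1 : 0 < 1 - b by lra.
  rewrite mulrC ler_pdivrMr ?exprn_gt0//.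
  rewrite /D /P !(bigID (fun y => y <= b) (fun y => y != _)) /= -mulrA.
  have -> : \prod_(y <- Y | (y != b) && (y <= b)) `|b - y| =
            \prod_(y <- Y | (y != 0) && (y <= b)) y.
    rewrite -prod_endpoints_left; apply: eq_bigr => y /andP[_ yb].
    by rewrite ger0_norm ?subr_ge0.
  apply: ler_wpM2l.
    rewrite big_seq_cond prodr_ge0// => y /and3P[yY y0 _].
    exact: le_trans (ltW (lp _)) (geY _ yY y0).
  (* Used for [c = b] and [c = 0]: since [1 - b >= 2 * b], neither excluded node lies in the right
     half, so both products run over the same nodes. *)
  have E (F : R -> R) c : c < b + b ->
      \prod_(y <- Y | (y != c) && ~~ (y <= b)) F y =
      \prod_(y <- Y | 1 - b <= y) F y.
    move=> cb; rewrite big_seq_cond [RHS]big_seq_cond; apply: eq_bigl => y.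
    case: (boolP (y \in Y)) => //= yY; apply/andP/idP => [[_]|yb].
      exact: rY.
    by split; [apply/eqP|rewrite -ltNge]; lra.
  rewrite !E; [|lra..].
  (* From [y <= 1] follows [y - b <= (1 - b) * y]. As [1 - b < 1], a lower bound on the number of
     right nodes then suffices. *)
  apply: (@le_trans _ _ (\prod_(y <- Y | 1 - b <= y) ((1 - b) * y))).
    rewrite big_seq_cond [leRHS]big_seq_cond.
    apply: ler_prod => y /andP[yY yb]; rewrite normr_ge0 ler0_norm; last lra.
    by have := leY _ yY; rewrite opprB; nra.
  rewrite big_split /= mulrC; apply: ler_wpM2l.
    by rewrite big_seq_cond prodr_ge0// => y /andP[yY yb]; lra.
  rewrite big_const_seq iter_mulr_1 ler_wiXn2l//; [lra..|].
  exact: count_endpoints_right.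
rewrite /lagrange_basis normr_prod.
under eq_bigr do rewrite normf_div.
rewrite prodf_div -/N -/D ler_pdivlMr// -[leLHS]mulrA.
(* The value to bound is now [N / D]. The bound on [D] reduces the claim to [x / (2 * b) * P <= N],
   which follows from [P / 2 <= M] and [x * M = (b - x) * N <= b * N]. *)
apply: (@le_trans _ _ (x / (2 * b) * P)).
  by apply: ler_wpM2l DP; rewrite ltW// divr_gt0 ?mulr_gt0.
apply: (@le_trans _ _ (x * M / b)).
  rewrite invfM mulrA mulrAC -!mulrA ler_pM2l// mulrA ler_pM2r ?invr_gt0//.
  by rewrite mulrC.
rewrite xMN ler_pdivrMr// mulrC ler_wpM2l//; first exact: prodr_ge0.
by lra.
Qed.

End LowerBound.

(** * Doubly exponential growth against exponential decay, and the limit *)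

(** Since [n * n <= 2 ^ n] from [n = 4] on, the expression is at least the [n]-th power of
    [b ^+ 2 / (1 - b) ^+ n]. That base is eventually at least 2, and [2 ^ n >= n >= A] for large
    [n]. *)
Lemma near_exp_doubling_ge (R : realType) (b : R) (A : R) :
  0 < b -> b < 1 ->
  \forall n \near \oo, A <= b ^+ (2 * n) * (1 - b) ^- (2 ^ n).
Proof.
move=> b0 b1; have q0 : 0 < 1 - b by lra.
have q1 : `|1 - b| < 1 by rewrite gtr0_norm//; lra.
have sqr n : (4 <= n)%N -> (n * n <= 2 ^ n)%N.
  move=> /subnK <-; elim: (n - 4)%N => // m; rewrite addSn expnS; lia.
have e0 : 0 < b ^+ 2 / 2 by rewrite divr_gt0 ?exprn_gt0.
near=> n.
have n4 : (4 <= n)%N by near: n; exact: nbhs_infty_ge.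
have qn : (1 - b) ^+ n <= b ^+ 2 / 2.
  near: n; have /cvgr0Pnorm_le/(_ _ e0) := cvg_expr q1.
  by apply: filterS => n; exact: le_trans (ler_norm _).
have An : A <= n%:R by near: n; exact: nbhs_infty_ger.
have qn0 : 0 < (1 - b) ^+ n by rewrite exprn_gt0.
apply: (@le_trans _ _ (b ^+ (2 * n) * (1 - b) ^- (n * n))); last first.
  rewrite ler_wpM2l ?exprn_ge0 ?(ltW b0)// lef_pV2 ?posrE ?exprn_gt0//.
  by apply: ler_wiXn2l; [lra..|exact: sqr].
rewrite !exprM -exprVn -exprMn.
apply: (le_trans An); apply: (@le_trans _ _ (2 ^+ n)).
  by rewrite -natrX ler_nat ltnW// ltn_expl.
apply: lerXn2r;
  rewrite ?nnegrE ?mulr_ge0 ?exprn_ge0 ?invr_ge0 ?(ltW qn0) ?(ltW b0)//.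
by rewrite ler_pdivlMr//; lra.
Unshelve. all: by end_near.
Qed.

Theorem theorem3p2 (R : realType) (beta : R) (hbeta0 : 0 < beta)
    (hbeta1 : beta <= 1 / 3) :
  lebesgue_constant (endpoints (fun s : nat => beta ^+ s) s.-1)
    (cantor_set (fun s : nat => beta ^+ s)) @[s --> \oo] --> +oo%E.
Proof.
pose l s : R := beta ^+ s.
have hl : cantor_scale l := cantor_scale_geometric hbeta0 hbeta1.
(* With [s = k + 2] the node level [s.-1] is [k.+1], so [l 1] is among the nodes. *)
rewrite -(cvg_shiftn 2); apply/cvgeyPge => A.
(* For the [x] chosen below, [x / (2 * beta)] equals [beta ^+ (2 * k.+1) * (beta / 2)], whence the
   constant [beta / 2]. *)
have [||N _ HN] := @near_exp_doubling_ge R beta (A / (beta / 2)); [lra..|].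
exists N => // k /= Nk; rewrite addn2 /=.
apply: ereal_sup_ge.
(* As [2 * k.+2 = k.+1 + k.+3], the smallness condition on [x] reduces to
   [(2 * beta) ^+ k.+3 <= 1]. *)
pose x := l (2 * k.+2)%N.
exists (lebesgue_function (endpoints l k.+1) x)%:E.
  by exists x => //; exact: cantor_set_scale.
rewrite lee_fin.
have x0 : 0 < x by rewrite exprn_gt0.
have xl : x * 2 ^+ k.+3 <= l k.+1.
  rewrite /x /l; have -> : (2 * k.+2 = k.+1 + k.+3)%N by lia.
  rewrite exprD -mulrA ler_piMr ?exprn_ge0// ?(ltW hbeta0)// -exprMn.
  by apply: exprn_ile1; lra.
have l1Z : l 1%N \in enum_fset (endpoints l k.+1).
  by rewrite mem_endpoints; apply: endpoint_seq_le (endpoint_leftr 1 hl).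
rewrite /lebesgue_function (bigD1_seq (l 1%N)) ?fset_uniq//=.
apply: ler_wpDr; first exact: sumr_ge0.
apply: le_trans (lagrange_basis_ge hl x0 xl).
have := HN k.+1 (leq_trans Nk (leqnSn _)).
rewrite ler_pdivrMr ?divr_gt0// => /le_trans; apply.
rewrite mulrAC ler_wpM2r//; first by rewrite invr_ge0 exprn_ge0//; lra.
rewrite /x /l expr1 (mulnS 2 k.+1) exprD.
suff -> : forall u : R, beta ^+ 2 * u / (2 * beta) = u * (beta / 2) by [].
by move=> u; field; rewrite gt_eqF.
Qed.
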